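(* Let $P$ be a program and let $(\beta_{\bullet l},\beta_{l\bullet})_{l}$ be the defined variables analysis result for $P$. Let $\langle l_0,\sigma_0\rangle\rightarrow\cdots\rightarrow\langle l_i,\sigma_i\rangle$ be a finite execution of $P$, where $l_0=\mathbf{first}(P)$ and $\sigma_0=\emptyset$ is the empty state, and let $b$ be a boolean expression with $\mathbf{vars}(b)\subseteq\beta_{\bullet l_i}$. Then there is a truth value $t$ with $\langle b,\sigma_i\rangle\rightarrow t$.
   Context: Language. $N$ is the set of integers, $T=\{\mathbf{true},\mathbf{false}\}$, $V$ a set of variables, $L$ a set of labels. Arithmetic expressions $E$: $e::=n\mid v\mid e_0+e_1\mid e_0-e_1\mid e_0\times e_1$ ($n\in N$, $v\in V$). Boolean expressions $B$: $b::=\mathbf{true}\mid\mathbf{false}\mid e_0=e_1\mid e_0\le e_1\mid\mathbf{not}\,b\mid b_0\,\mathbf{and}\,b_1\mid b_0\,\mathbf{or}\,b_1$. Commands: $c::=\mathbf{skip}\mid v:=e\mid\mathbf{if}\,b\,\mathbf{then}\,g\mid\mathbf{goto}\,g\mid\mathbf{halt}\mid\mathbf{done}$ ($g\in L$). $\mathbf{vars}(b)$ is the set of variables occurring in $b$. A program $P$ is a sequence of labeled commands $l:c$ with pairwise distinct labels; $\mathbf{first}(P)$ is the label of the first command to execute; $\mathbf{next}(l)$ is the label of the command following $l$ in the sequence. If $l:\mathbf{halt}\in P$ then $\mathbf{next}(l):\mathbf{done}\in P$. Branch targets $g$, and $\mathbf{next}(l)$ for each assignment, $\mathbf{skip}$,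 $\mathbf{if}$ or $\mathbf{halt}$ command at $l$, are labels of $P$. Successors: $\mathbf{succ}(l)=\{\mathbf{next}(l)\}$ for assignment, $\mathbf{skip}$, $\mathbf{halt}$; $\{g\}$ for $\mathbf{goto}\,g$; $\{\mathbf{next}(l),g\}$ for $\mathbf{if}\,b\,\mathbf{then}\,g$; $\emptyset$ for $\mathbf{done}$. Predecessors: $\mathbf{pred}(l)=\{g: l\in\mathbf{succ}(g)\}$. Standard semantics. A state is a partial function $\sigma:V\rightharpoonup N$ with domain $\mathrm{dom}\,\sigma$. The evaluation relations $\langle e,\sigma\rangle\rightarrow n$ and $\langle b,\sigma\rangle\rightarrow t$ are the least relations with: constants evaluate to themselves; $\langle v,\sigma\rangle\rightarrow\sigma(v)$ if $v\in\mathrm{dom}\,\sigma$; a compound expression evaluates to the result of applying its operator to the values of all of its immediate subexpressions, provided all of these evaluate (no short-circuiting). The relation $\langle l,\sigma\rangle\rightarrow\langle l',\sigma'\rangle$ is the least relation with: if $l:v:=e\in P$ and $\langle e,\sigma\rangle\rightarrow n$, then $\langle l,\sigma\rangle\rightarrow\langle\mathbf{next}(l),\sigma[v\mapsto n]\rangle$; if $l:\mathbf{if}\,b\,\mathbf{then}\,g\in P$, then $\langle l,\sigma\rangle\rightarrow\langle g,\sigma\rangle$ when $\langle b,\sigma\rangle\rightarrow\mathbf{true}$ and $\langle l,\sigma\rangle\rightarrow\langle\mathbf{next}(l),\sigma\rangle$ when $\langle b,\sigma\rangle\rightarrow\mathbf{false}$; if $l:\mathbf{goto}\,g\in P$, then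 $\langle l,\sigma\rangle\rightarrow\langle g,\sigma\rangle$; if $l:\mathbf{skip}\in P$, or $l:\mathbf{halt}\in P$ and $\mathbf{next}(l):\mathbf{done}\in P$, then $\langle l,\sigma\rangle\rightarrow\langle\mathbf{next}(l),\sigma\rangle$. Defined variables analysis. $\beta_{\bullet l},\beta_{l\bullet}\subseteq V$, for $l$ ranging over the labels of $P$, are the least solution with respect to componentwise reverse inclusion $\supseteq$ (i.e. the solution with the largest sets) of the equations: $\beta_{\bullet\mathbf{first}(P)}=\emptyset$; $\beta_{\bullet l}=\bigcap_{g\in\mathbf{pred}(l)}\beta_{g\bullet}$ for $l\ne\mathbf{first}(P)$ (an empty intersection being $V$); $\beta_{l\bullet}=f(l,\beta_{\bullet l})$, where $f(l,\beta)=\beta\cup\{v\}$ if $l:v:=e\in P$ and $f(l,\beta)=\beta$ otherwise. *)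

(* Defs.v *)
From HB Require Import structures.
From mathcomp Require Import all_boot all_order all_algebra.
From mathcomp Require Import boolp classical_sets.

Set Implicit Arguments.
Unset Strict Implicit.
Unset Printing Implicit Defensive.

Import Order.TTheory GRing.Theory Num.Theory.

Local Open Scope classical_set_scope.

Inductive aexpr (V : Type) : Type :=
| ANum of int
| AVar of V
| AAdd of aexpr V & aexpr V
| ASub of aexpr V & aexpr V
| AMul of aexpr V & aexpr V.
Arguments ANum {V} _.

Inductive bexpr (V : Type) : Type :=
| BTrue
| BFalse
| BEq of aexpr V & aexpr V
| BLe of aexpr V & aexpr V
| BNot of bexpr V
| BAnd of bexpr V & bexpr V
| BOr of bexpr V & bexpr V.
Arguments BTrue {V}.
Arguments BFalse {V}.

Inductive cmd (V L : Type) : Type :=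
| Skip
| Assign of V & aexpr V
| IfThen of bexpr V & L
| Goto of L
| Halt
| Done.
Arguments Skip {V L}.
Arguments Assign {V L} _ _.
Arguments IfThen {V L} _ _.
Arguments Goto {V L} _.
Arguments Halt {V L}.
Arguments Done {V L}.

(* Classical decidable equality, so that [(l, c) \in s] makes sense. *)
HB.instance Definition _ (V L : Type) := gen_eqMixin (cmd V L).

Fixpoint avars (V : Type) (e : aexpr V) : set V :=
  match e with
  | ANum _ => set0
  | AVar v => [set v]
  | AAdd e0 e1 | ASub e0 e1 | AMul e0 e1 => avars e0 `|` avars e1
  end.

Fixpoint bvars (V : Type) (b : bexpr V) : set V :=
  match b with
  | BTrue | BFalse => set0
  | BEq e0 e1 | BLe e0 e1 => avars e0 `|` avars e1
  | BNot b0 => bvars b0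
  | BAnd b0 b1 | BOr b0 b1 => bvars b0 `|` bvars b1
  end.

(* [None] when [l] is the last label of [s], or does not occur in [s]. *)
Definition next_in (V : Type) (L : eqType) (s : seq (L * cmd V L)) (l : L) :
    option L :=
  onth (unzip1 s) (index l (unzip1 s)).+1.

(* The entry label is a datum of the program: it need not label the head of
   the sequence. *)
Record program (V : Type) (L : eqType) := Program {
  code : seq (L * cmd V L);
  first_label : L;
  labels : seq L := unzip1 code;
  labels_uniq : uniq labels;
  first_labelP : first_label \in labels;
  halt_done : forall l, (l, Halt) \in code ->
    exists2 l', next_in code l = Some l' & (l', Done) \in code;
  goto_target : forall l g, (l, Goto g) \in code -> g \in labels;
  if_target : forall l b g, (l, IfThen b g) \in code -> g \in labels;
  skip_next : forall l, (l, Skip) \in code ->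
    exists2 l', next_in code l = Some l' & l' \in labels;
  assign_next : forall l v e, (l, Assign v e) \in code ->
    exists2 l', next_in code l = Some l' & l' \in labels;
  if_next : forall l b g, (l, IfThen b g) \in code ->
    exists2 l', next_in code l = Some l' & l' \in labels;
  halt_next : forall l, (l, Halt) \in code ->
    exists2 l', next_in code l = Some l' & l' \in labels
}.

Definition next_label (V : Type) (L : eqType) (P : program V L) (l : L) :
    option L :=
  next_in (code P) l.

Definition cmd_succ (L : Type) (V : Type) (next : option L) (c : cmd V L) :
    set L :=
  match c with
  | Skip | Assign _ _ | Halt => [set l' | next = Some l']
  | IfThen _ g => [set l' | next = Some l'] `|` [set g]
  | Goto g => [set g]
  | Done => set0
  end.

Definition succ_labels (V : Type) (L : eqType) (P : program V L) (l : L) :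
    set L :=
  [set l' | exists2 c, (l, c) \in code P & cmd_succ (next_label P l) c l'].

Definition pred_labels (V : Type) (L : eqType) (P : program V L) (l : L) :
    set L :=
  [set g | succ_labels P g l].

Definition state (V : Type) := V -> option int.

Definition empty_state (V : Type) : state V := fun _ => None.
Arguments empty_state V : clear implicits.

Definition update (V : eqType) (s : state V) (v : V) (n : int) : state V :=
  fun w => if w == v then Some n else s w.

Inductive aeval (V : Type) (s : state V) : aexpr V -> int -> Prop :=
| aeval_num n : aeval s (ANum n) n
| aeval_var v n : s v = Some n -> aeval s (AVar v) n
| aeval_add e0 e1 n0 n1 : aeval s e0 n0 -> aeval s e1 n1 ->
    aeval s (AAdd e0 e1) (n0 + n1)%R
| aeval_sub e0 e1 n0 n1 : aeval s e0 n0 -> aeval s e1 n1 ->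
    aeval s (ASub e0 e1) (n0 - n1)%R
| aeval_mul e0 e1 n0 n1 : aeval s e0 n0 -> aeval s e1 n1 ->
    aeval s (AMul e0 e1) (n0 * n1)%R.

Inductive beval (V : Type) (s : state V) : bexpr V -> bool -> Prop :=
| beval_true : beval s BTrue true
| beval_false : beval s BFalse false
| beval_eq e0 e1 n0 n1 : aeval s e0 n0 -> aeval s e1 n1 ->
    beval s (BEq e0 e1) (n0 == n1)
| beval_le e0 e1 n0 n1 : aeval s e0 n0 -> aeval s e1 n1 ->
    beval s (BLe e0 e1) (n0 <= n1)%R
| beval_not b t : beval s b t -> beval s (BNot b) (~~ t)
| beval_and b0 b1 t0 t1 : beval s b0 t0 -> beval s b1 t1 ->
    beval s (BAnd b0 b1) (t0 && t1)
| beval_or b0 b1 t0 t1 : beval s b0 t0 -> beval s b1 t1 ->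
    beval s (BOr b0 b1) (t0 || t1).

Inductive step (V L : eqType) (P : program V L) :
    L * state V -> L * state V -> Prop :=
| step_assign l l' s v e n :
    (l, Assign v e) \in code P -> next_label P l = Some l' -> aeval s e n ->
    step P (l, s) (l', update s v n)
| step_if_true l s b g :
    (l, IfThen b g) \in code P -> beval s b true ->
    step P (l, s) (g, s)
| step_if_false l l' s b g :
    (l, IfThen b g) \in code P -> next_label P l = Some l' ->
    beval s b false ->
    step P (l, s) (l', s)
| step_goto l s g :
    (l, Goto g) \in code P ->
    step P (l, s) (g, s)
| step_skip l l' s :
    (l, Skip) \in code P -> next_label P l = Some l' ->
    step P (l, s) (l', s)
| step_halt l l' s :
    (l, Halt) \in code P -> next_label P l = Some l' ->
    (l', Done) \in code P ->
    step P (l, s) (l', s).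

Definition transfer (V L : Type) (c : cmd V L) (B : set V) : set V :=
  match c with
  | Assign v _ => B `|` [set v]
  | _ => B
  end.

(* [pre l] and [post l] are the sets before and after the command at [l]; their
   values outside [labels P] are irrelevant. *)
Definition dva_solution (V : Type) (L : eqType) (P : program V L)
    (pre post : L -> set V) : Prop :=
  [/\ pre (first_label P) = set0,
      forall l, l \in labels P -> l <> first_label P ->
        pre l = \bigcap_(g in pred_labels P l) post g
    & forall l c, (l, c) \in code P -> post l = transfer c (pre l)].

(* The least solution for reverse inclusion has the largest sets. *)
Definition defined_variables (V : Type) (L : eqType) (P : program V L)
    (pre post : L -> set V) : Prop :=
  dva_solution P pre post /\
  forall pre' post' : L -> set V, dva_solution P pre' post' ->
    forall l, l \in labels P -> pre' l `<=` pre l /\ post' l `<=` post l.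

(* Main.v *)
(** The successor relation over-approximates [step], and executing a command
    enlarges the domain of the state at least as much as its transfer function
    enlarges a set of variables. Hence the dataflow equations make
    [pre l `<=` dom s] an invariant of the configurations [(l, s)] reached from
    the entry, where [pre] is empty. *)
Require Import Defs.
From mathcomp Require Import all_boot all_order all_algebra.
From mathcomp Require Import boolp classical_sets.

Local Open Scope classical_set_scope.

Definition dom {V : Type} (s : state V) : set V := [set v | isSome (s v)].

(** Every operator is total on integers, so evaluation can only get stuck at a variable outside
    [dom s]. *)
Lemma aeval_total {V : Type} (s : state V) (e : aexpr V) :
  avars e `<=` dom s -> exists n, aeval s e n.
Proof.
elim: e => [n|v|e0 IH0 e1 IH1|e0 IH0 e1 IH1|e0 IH0 e1 IH1] /=.
- by exists n; constructor.
- move=> /(_ v erefl); rewrite /dom /=.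
  by case Esv: (s v) => [n|//] _; exists n; constructor.
all: rewrite subUset => -[/IH0[n0 ?] /IH1[n1 ?]]; eexists; constructor; eassumption.
Qed.

Lemma beval_total {V : Type} (s : state V) (b : bexpr V) :
  bvars b `<=` dom s -> exists t, beval s b t.
Proof.
elim: b => [||e0 e1|e0 e1|b IH|b0 IH0 b1 IH1|b0 IH0 b1 IH1] /=.
- by exists true; constructor.
- by exists false; constructor.
- rewrite subUset => -[/aeval_total[n0 ?] /aeval_total[n1 ?]].
  by eexists; constructor; eassumption.
- rewrite subUset => -[/aeval_total[n0 ?] /aeval_total[n1 ?]].
  by eexists; constructor; eassumption.
- by move=> /IH[t ?]; exists (~~ t); constructor.
all: rewrite subUset => -[/IH0[t0 ?] /IH1[t1 ?]]; eexists; constructor; eassumption.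
Qed.

Lemma transferS {V L : Type} (c : cmd V L) {A B : set V} :
  A `<=` B -> transfer c A `<=` transfer c B.
Proof. by case: c => //= v e; apply: setSU. Qed.

Lemma next_label_mem {V : Type} {L : eqType} {P : program V L} {l l'} :
  next_label P l = Some l' -> l' \in labels P.
Proof. by move=> next_l; apply/onthP; eexists; exact: next_l. Qed.

(** Gathers all that the dataflow argument needs to know about a step, so that the case analysis on
    commands happens only here. Only an assignment alters the state. *)
Lemma step_transfer {V L : eqType} {P : program V L} {x x' : L * state V} :
  step P x x' ->
  exists c, [/\ (x.1, c) \in code P, cmd_succ (next_label P x.1) c x'.1,
                x'.1 \in labels P & transfer c (dom x.2) `<=` dom x'.2].
Proof.
case=> [l l' s v e n lc nl _|l s b g lc _|l l' s b g lc nl _|l s g lc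
       |l l' s lc nl|l l' s lc nl _] /=.
- exists (Assign v e); split=> //; first exact: next_label_mem nl.
  move=> w /=; rewrite /dom /update /=.
  (* At [v] the update is defined; at any other variable both sides reduce to [dom s]. *)
  by case: eqVneq => // /eqP wv [//|/wv].
- by exists (IfThen b g); split=> //; [right|exact: if_target lc].
- by exists (IfThen b g); split=> //; [left|exact: next_label_mem nl].
- by exists (Goto g); split=> //; exact: goto_target lc.
- by exists Skip; split=> //; exact: next_label_mem nl.
- by exists Halt; split=> //; exact: next_label_mem nl.
Qed.

(** Since [l] is a predecessor of [l'], the intersection defining [pre l'] lies in
    [post l = transfer c (pre l)], and [transfer c] is monotone. *)
Lemma dva_step {V L : eqType} {P : program V L} {pre post : L -> set V}
    {l s l' s'} :
  dva_solution P pre post -> step P (l, s) (l', s') ->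
  pre l `<=` dom s -> pre l' `<=` dom s'.
Proof.
move=> [pre_first pre_next postE] /step_transfer[c /= [lc succ_l' l'P sub_s']] sub_s.
(* Execution may jump back to the entry, whose equation is not an intersection over predecessors. *)
have [->|/eqP l'_first] := eqVneq l' (first_label P).
  by rewrite pre_first; exact: sub0set.
rewrite pre_next // => v /(_ l) post_v; apply: sub_s'; apply: (transferS c sub_s).
by rewrite -(postE _ _ lc); apply: post_v; exists c.
Qed.

Theorem theorem5p6 (V L : eqType) (P : program V L) (pre post : L -> set V)
    (Hdva : defined_variables P pre post)
    (i : nat) (l : nat -> L) (s : nat -> state V)
    (Hl0 : l 0%N = first_label P) (Hs0 : s 0%N = empty_state V)
    (Hexec : forall k : nat, (k < i)%N ->
       step P (l k, s k) (l k.+1, s k.+1))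
    (b : bexpr V) (Hb : bvars b `<=` pre (l i)) :
  exists t : bool, beval (s i) b t.
Proof.
have [sol _] := Hdva.
(* The induction stops at [i] because [Hexec] provides steps only from indices below [i]. *)
suff inv k : k <= i -> pre (l k) `<=` dom (s k).
  by apply: beval_total; apply: subset_trans Hb (inv i (leqnn i)).
elim: k => [_|k IHk ki]; first by have [pre_first _ _] := sol; rewrite Hl0 pre_first.
exact: dva_step sol (Hexec k ki) (IHk (ltnW ki)).
Qed.
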